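(* Let $d\in\{1,2,3\}$, let $K\subset\mathbb{R}^d$ be a $d$-dimensional simplex, let $F\subset\partial K$ be one of its $(d-1)$-dimensional faces, let $q\in(0,\infty)$ and $r\in\mathbb{N}_0$. Then, for every polynomial $v\in\mathcal{P}_r(K)$, $$\int_F |v|^q \,\mathrm{d}s \leq 2^{q+1}C_{\mathrm{inv},d}\,\frac{(2r^2+1)|F|}{d\,|K|}\int_K |v|^q\,\mathrm{d}\mathbf{x},$$ where $C_{\mathrm{inv},d}=1,4,8$ for $d=1,2,3$, respectively.
   Context: $\mathcal{P}_r(K)$ denotes the real polynomials of total degree at most $r$ on $K$; $|K|$ is the $d$-dimensional Lebesgue measure and $|F|$ the $(d-1)$-dimensional measure. For $d=1$, $K$ is a bounded interval, a face $F$ is one of its endpoints, the integral over $F$ is point evaluation and $|F|=1$. *)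

(* Defs.v *)
From HB Require Import structures.
From mathcomp Require Import all_boot all_order all_algebra.
(* mpoly clashes with mathcomp-analysis: on notations, and on the names
   Measure and isMeasure, which must come from the latter. *)
From mathcomp Require Import -(notations) mpoly.
From mathcomp Require Import all_classical all_reals all_analysis.
From mathcomp Require Import measurable_realfun.

Set Implicit Arguments.
Unset Strict Implicit.
Unset Printing Implicit Defensive.

Import Order.TTheory GRing.Theory Num.Theory.
Import numFieldTopology.Exports numFieldNormedType.Exports.

Local Open Scope classical_set_scope.
Local Open Scope ring_scope.

(* R^d with the product of the Borel sigma-algebras of the coordinates. *)
Notation Rn R d := (d.-tuple (measurableTypeR R)).

Section lebesgue_cons.
Context {R : realType} {d : nat}.
Local Open Scope ereal_scope.

Definition cons_Rn (p : measurableTypeR R * Rn R d) : Rn R d.+1 :=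
  [the d.+1.-tuple (measurableTypeR R) of p.1 :: p.2].

Definition uncons_Rn (x : Rn R d.+1) : measurableTypeR R * Rn R d :=
  (thead x, [tuple of behead x]).

Lemma measurable_cons_Rn : measurable_fun setT cons_Rn.
Proof.
by apply: measurable_cons; [exact: measurable_fst|exact: measurable_snd].
Qed.

Lemma measurable_uncons_Rn : measurable_fun setT uncons_Rn.
Proof.
apply: measurable_fun_pair; last exact: measurable_behead.
exact: measurable_tnth.
Qed.

Lemma cons_RnK : cancel cons_Rn uncons_Rn.
Proof. by move=> [x y]; congr pair; exact/val_inj. Qed.

Variable m : {sigma_finite_measure set (Rn R d) -> \bar R}.

Definition lebesgue_cons := pushforward (lebesgue_measure \x m) cons_Rn.

Let lebesgue_cons0 : lebesgue_cons set0 = 0.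
Proof. by rewrite /lebesgue_cons /pushforward preimage_set0 measure0. Qed.

Let lebesgue_cons_ge0 A : 0 <= lebesgue_cons A.
Proof. exact: (measure_ge0 (lebesgue_measure \x m)%E). Qed.

Let lebesgue_cons_sigma_additive : semi_sigma_additive lebesgue_cons.
Proof.
exact: (@measure_semi_sigma_additive _ _ _
  (measure_function_pushforward__canonical__measure_function_Measure
    (lebesgue_measure \x m)%E measurable_cons_Rn)).
Qed.

HB.instance Definition _ := isMeasure.Build _ _ _ lebesgue_cons
  lebesgue_cons0 lebesgue_cons_ge0 lebesgue_cons_sigma_additive.

Let lebesgue_cons_sigma_finite : sigma_finite setT lebesgue_cons.
Proof.
have /sigma_finiteP[F [TF ndF Foo]] := sigma_finiteT (@lebesgue_measure R).
have /sigma_finiteP[G [TG ndG Goo]] := sigma_finiteT m.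
exists (fun n => uncons_Rn @^-1` (F n `*` G n)).
  apply/seteqP; split=> // x _.
  have [j _ Fj] : (\bigcup_n F n) (uncons_Rn x).1 by rewrite -TF.
  have [k _ Gk] : (\bigcup_n G n) (uncons_Rn x).2 by rewrite -TG.
  exists (maxn j k) => //; split.
    by move: Fj; apply/subsetPset/ndF/leq_maxl.
  by move: Gk; apply/subsetPset/ndG/leq_maxr.
move=> n; have [mF Fn] := Foo n; have [mG Gn] := Goo n; split.
  rewrite -[X in measurable X]setTI; apply: measurable_uncons_Rn => //.
  exact: measurableX.
rewrite /lebesgue_cons /pushforward -comp_preimage.
rewrite (_ : _ \o _ = id) ?preimage_id; last exact/funext/cons_RnK.
by rewrite product_measure1E// lte_mul_pinfty// ge0_fin_numE.
Qed.

HB.instance Definition _ := Measure_isSigmaFinite.Build _ _ _ lebesgue_cons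
  lebesgue_cons_sigma_finite.

End lebesgue_cons.

(* lebesgue_measure \x ... \x lebesgue_measure; on the one-point space R^0 it
   is the unit mass. *)
Fixpoint lebesgue (R : realType) (d : nat) :
    {sigma_finite_measure set (Rn R d) -> \bar R} :=
  match d with
  | 0 => \d_([tuple] : Rn R 0)
  | d'.+1 => lebesgue_cons (lebesgue R d')
  end.

Lemma lebesgue_box (R : realType) (d : nat) (A : 'I_d -> set (measurableTypeR R)) :
  (forall i, measurable (A i)) ->
  lebesgue R d [set x | forall i, A i (tnth x i)] =
  (\prod_(i < d) lebesgue_measure (A i))%E.
Proof.
elim: d A => [|d IH] A mA.
  rewrite big_ord0 /= diracE mem_set//.
  by case.
rewrite big_ord_recl -IH; last by move=> i; exact: mA.
rewrite -product_measure1E//; last first.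
  rewrite (_ : [set _ | _] = \bigcap_(i in [set: 'I_d])
    ((fun x : Rn R d => tnth x i) @^-1` A (lift ord0 i))).
    apply: fin_bigcap_measurable => // i _.
    by rewrite -[X in measurable X]setTI; apply: measurable_tnth => //; exact: mA.
  by apply/seteqP; split=> [x xA i _|x xA i]; apply: xA.
congr (product_measure1 _ _ _); apply/seteqP; split=> [[x y]|[x y] [Ax Ay]] /=.
  move=> xyA; split; first exact: (xyA ord0).
  by move=> i; move: (xyA (lift ord0 i)); rewrite /= tnthS.
by move=> i; have [j ->|->//] := unliftP ord0 i; rewrite tnthS; exact: Ay.
Qed.

Section simplices.
Context {R : realType} {m d : nat}.
Implicit Type a : 'I_m.+1 -> Rn R d.

Definition edge_mx a : 'M[R]_(m, d) :=
  \matrix_(k, j) (tnth (a (lift ord0 k)) j - tnth (a ord0) j).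

Definition affinely_independent a : bool := row_free (edge_mx a).

Definition simplex a : set (Rn R d) :=
  [set x | exists w : 'I_m.+1 -> R,
    [/\ forall k, 0 <= w k, \sum_k w k = 1 &
        forall j, tnth x j = \sum_k w k * tnth (a k) j]].

Definition affine_chart a (y : Rn R m) : Rn R d :=
  [tuple tnth (a ord0) j + \sum_k tnth y k * edge_mx a k j | j < d].

Lemma measurable_affine_chart a : measurable_fun setT (affine_chart a).
Proof.
apply/measurable_fun_tnthP => j; rewrite (_ : _ \o _ = fun y =>
  tnth (a ord0) j + \sum_k tnth y k * edge_mx a k j); last first.
  by apply/funext => y /=; rewrite tnth_mktuple.
apply: measurable_funD => //; apply: measurable_sum => k.
by apply: measurable_funM => //; exact: measurable_tnth.
Qed.

(* The m-dimensional surface measure on the affine span of a: by the area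
   formula, the image of the Lebesgue measure of R^m under the chart, scaled by
   the square root of the Gram determinant of the edges. It does not depend on
   which affinely independent points of the span are used. For m = 0 the Gram
   determinant is 1 and this is the unit mass at the single point of a. *)
Definition surface_measure a : set (Rn R d) -> \bar R := fun A =>
  ((Num.sqrt (\det (edge_mx a *m (edge_mx a)^T)))%:E *
   pushforward (lebesgue R m) (affine_chart a) A)%E.

HB.instance Definition _ a := Measure.copy (surface_measure a)
  (mscale (NngNum (sqrtr_ge0 (\det (edge_mx a *m (edge_mx a)^T))))
    (measure_function_pushforward__canonical__measure_function_Measure
      (lebesgue R m) (measurable_affine_chart a))).

End simplices.

Lemma surface_measure_point (R : realType) (d : nat) (a : 'I_1 -> Rn R d) :
  surface_measure a = \d_(a ord0).
Proof.
apply/funext => A; rewrite /surface_measure det_mx00 sqrtr1 mul1e.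
rewrite /pushforward /= !diracE; congr ((_ : bool)%:R%:E).
suff <- : affine_chart a [tuple] = a ord0 by apply/idP/idP; rewrite !inE.
by apply: eq_from_tnth => j; rewrite tnth_mktuple big_ord0 addr0.
Qed.

(* The vertices of the face opposite to the vertex a i. *)
Definition face_vertices (R : realType) (d m : nat) (a : 'I_m.+2 -> Rn R d)
  (i : 'I_m.+2) : 'I_m.+1 -> Rn R d := fun k => a (lift i k).

(* msize is one more than the total degree, and 0 for the zero polynomial. *)
Definition polynomials_on (R : realType) (d r : nat) (K : set (Rn R d)) :
    set (Rn R d -> R) :=
  [set v | exists2 p : mpoly.mpoly d R, (mpoly.msize p <= r.+1)%N &
    forall x, K x -> v x = mpoly.meval (tnth x) p].

Definition C_inv (R : realType) (d : nat) : R :=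
  match d with 1 => 1 | 2 => 4 | 3 => 8 | _ => 0 end.

(* Main.v *)
(* Every point of K lies on a segment joining a point of F to the opposite vertex
   P. In the coordinates (t, z) -> (1 - t) z + t P the integral over K becomes
     h * \int_F \int_0^1 (1 - t)^(d-1) |v|^q dt ds,   h = d |K| / |F|,
   so that it suffices to bound |g(0)|^q by the weighted integral of |g|^q over
   [0, 1] for a univariate polynomial g of degree at most r. If |g| <= M on [a, b]
   then |g'(a)| (b - a) <= 2 r^2 M, by comparison with the Chebyshev polynomial.
   Let |g| attain its maximum M over an interval at x0. Applying this bound on the
   segments from the points near x0 to the ends of the interval shows that
   |g| >= M / 2 on a subinterval of relative length 1 / (4 r^2 + 1).
   The Jacobians of the charts need not be computed: an affine bijection scales
   Lebesgue measure by some factor, because translation invariant measures are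
   proportional, and this factor cancels. *)
From HB Require Import structures.
Require Import Defs.
From mathcomp Require Import all_boot all_order all_fingroup all_algebra.
From mathcomp Require Import -(notations) mpoly.
From mathcomp Require Import all_classical all_reals all_analysis.
From mathcomp Require Import measurable_realfun polyrcf ring lra.

Set Implicit Arguments.
Unset Strict Implicit.
Unset Printing Implicit Defensive.

Import Order.TTheory GRing.Theory Num.Theory.
Import numFieldTopology.Exports numFieldNormedType.Exports.

Local Open Scope classical_set_scope.
Local Open Scope ring_scope.

(** * Markov's inequality at an endpoint *)

Fixpoint chebyshev (R : nzRingType) (n : nat) : {poly R} :=
  match n with
  | 0 => 1
  | n'.+1 => if n' is n''.+1 then 'X *+ 2 * chebyshev R n' - chebyshev R n''
             else 'X
  end.

Section chebyshev_theory.
Variable R : realType.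
Local Notation T := (chebyshev R).
Implicit Types (n k : nat) (p : {poly R}).

Lemma chebyshevSS n : T n.+2 = 'X *+ 2 * T n.+1 - T n.
Proof. by []. Qed.

Lemma chebyshev_ind2 (P : nat -> Prop) :
  P 0 -> P 1 -> (forall n, P n -> P n.+1 -> P n.+2) -> forall n, P n.
Proof.
move=> P0 P1 PS n; suff [] : P n /\ P n.+1 by [].
by elim: n => // n [Pn PSn]; split=> //; exact: PS.
Qed.

Lemma size_chebyshev n : (size (T n) <= n.+1)%N.
Proof.
elim/chebyshev_ind2: n => [||n IH1 IH2]; rewrite ?size_poly1 ?size_polyX//.
rewrite chebyshevSS (leq_trans (size_polyD _ _))// geq_max size_polyN.
apply/andP; split; last by rewrite (leq_trans IH1)// leqW.
rewrite mulrnAl -mulrnAr (leq_trans (size_polyMleq _ _))// size_polyX add2n /=.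
by rewrite ltnS (leq_trans _ IH2)// mulr2n (leq_trans (size_polyD _ _))// maxnn.
Qed.

(** The recurrence matches the addition formulas applied to
    [cos ((n+1) x + x) + cos ((n+1) x - x)]. *)
Lemma chebyshev_cos n (x : R) : (T n).[cos x] = cos (n%:R * x).
Proof.
elim/chebyshev_ind2: n => [||n IH1 IH2].
- by rewrite hornerC mul0r cos0.
- by rewrite hornerX mul1r.
rewrite chebyshevSS !hornerE IH1 IH2.
have -> : n.+2%:R * x = n.+1%:R * x + x.
  by rewrite -[n.+2]addn1 natrD mulrDl mul1r.
have -> : n%:R * x = n.+1%:R * x - x.
  by rewrite -[n.+1]addn1 natrD mulrDl mul1r addrK.
by rewrite cosB cosD; ring.
Qed.

Lemma chebyshev1 n : (T n).[1] = 1.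
Proof. by rewrite -cos0 chebyshev_cos mulr0 cos0. Qed.

(** Differentiating the recurrence at 1 gives [u_(n+2) = 2 + 2 u_(n+1) - u_n], which [u_n = n^2]
    satisfies. *)
Lemma deriv_chebyshev1 n : (T n)^`().[1] = n%:R ^+ 2.
Proof.
elim/chebyshev_ind2: n => [||n IH1 IH2].
- by rewrite derivC hornerC expr0n.
- by rewrite derivX hornerC expr1n.
rewrite chebyshevSS derivB derivM derivMn derivX !hornerE IH1 IH2 chebyshev1.
rewrite -[n.+2]addn2 -[n.+1]addn1 !natrD; ring.
Qed.

(** By the product rule the derivative at 1 is a sum of products of factors [1 - z > 0]. *)
Lemma horner_deriv_prod_ge0 (s : seq R) :
  all (fun z => z < 1) s ->
  0 < (\prod_(z <- s) ('X - z%:P)).[1] /\ 0 <= (\prod_(z <- s) ('X - z%:P))^`().[1].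
Proof.
elim: s => [_|z s IH /= /andP[z1 /IH[P0 dP0]]].
  by rewrite big_nil derivC !hornerC.
rewrite big_cons derivM derivXsubC !hornerE; split; first by rewrite mulr_gt0// subr_gt0.
by rewrite addr_ge0 ?mulr_ge0 ?subr_ge0// ltW.
Qed.

(* For [c < 1], [T_n - c p] alternates in sign at the n + 1 extrema of T_n, so
   its n roots all lie to the left of 1, where its value is positive; hence its
   derivative at 1 is nonnegative. *)
Lemma markov_endpoint_le n p : (size p <= n.+1)%N ->
  (forall x, -1 <= x <= 1 -> `|p.[x]| <= 1) -> p^`().[1] <= n%:R ^+ 2.
Proof.
case: n => [|n] sp p1.
  by rewrite (size1_polyC sp) derivC hornerC expr0n.
(* Taking [c < 1] makes the alternation of signs strict. If [P = p'(1)] exceeded [(n+1)^2], then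
   [c = (P + (n+1)^2) / (2 P)] would be below 1, yet [c P], the mean of the two, would still exceed
   [(n+1)^2]. *)
suff H c : 0 <= c < 1 -> c * p^`().[1] <= n.+1%:R ^+ 2.
  rewrite leNgt; apply/negP => ltp.
  have p'0 : 0 < p^`().[1] by rewrite (le_lt_trans _ ltp)// exprn_ge0.
  set P := p^`().[1] in ltp p'0 H.
  have : (P + n.+1%:R ^+ 2) / (2 * P) * P <= n.+1%:R ^+ 2.
    apply: H; rewrite divr_ge0 ?addr_ge0 ?exprn_ge0 ?mulr_ge0 ?(ltW p'0)//=.
    by rewrite ltr_pdivrMr ?mulr_gt0//; lra.
  rewrite (_ : _ * P = (P + n.+1%:R ^+ 2) / 2); first by lra.
  by field; rewrite gt_eqF.
move=> /andP[c0 c1].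
pose q := T n.+1 - c *: p.
(* The extrema of the Chebyshev polynomial, decreasing from 1, with values [(-1)^k]. *)
pose x k : R := cos (k%:R * (pi / n.+1%:R)).
have xitv k : -1 <= x k <= 1 by rewrite cos_geN1 cos_le1.
have itv k : (k <= n.+1)%N -> k%:R * (pi / n.+1%:R) \in `[0, pi]%R.
  move=> kn; rewrite in_itv/= mulr_ge0 ?divr_ge0 ?pi_ge0//=.
  rewrite mulrA ler_pdivrMr ?ltr0n// mulrC ler_wpM2l ?pi_ge0//.
  by rewrite ler_nat.
have xlt k : (k < n.+1)%N -> x k.+1 < x k.
  move=> kn; rewrite ltr_cos ?itv//; last exact: ltnW.
  by rewrite ltr_pM2r ?divr_gt0 ?pi_gt0 ?ltr0n// ltr_nat.
have Tx k : (T n.+1).[x k] = (-1) ^+ k.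
  rewrite chebyshev_cos mulrCA [X in _ * X]mulrC divfK ?pnatr_eq0//.
  elim: k => [|k IH]; first by rewrite mul0r cos0.
  by rewrite -natr1 mulrDl mul1r cosDpi IH exprS mulN1r.
have qx k : 0 < (-1) ^+ k * q.[x k].
  rewrite !hornerE Tx mulrBr -expr2 sqrr_sign subr_gt0.
  rewrite (le_lt_trans (ler_norm _))// normrM normr_sign mul1r normrM.
  by rewrite (ger0_norm c0) (le_lt_trans _ c1)// ler_piMr// p1.
(* A root between consecutive extrema; the value 0 is a dummy for indices out of range. *)
have /choice[z zP] k : exists z, (k < n.+1)%N -> x k.+1 < z < x k /\ root q z.
  case: (ltnP k n.+1) => kn; last by exists 0.
  have [|z zx rz] := @poly_ivtoo R q (x k.+1) (x k) (ltW (xlt _ kn)); last first.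
    by exists z; move: zx; rewrite in_itv.
  have := mulr_gt0 (qx k) (qx k.+1).
  rewrite exprS mulrACA [(-1) ^+ k * _]mulrCA -expr2 sqrr_sign mulr1 mulN1r oppr_gt0.
  by rewrite [q.[x k] * _]mulrC.
pose s := mkseq z n.+1.
have zltS k : (k.+1 < n.+1)%N -> z k.+1 < z k.
  move=> kn; have [/andP[_ zx] _] := zP _ kn.
  by have [/andP[xz _] _] := zP _ (ltnW kn); exact: lt_trans zx xz.
have zlt j k : (j < k)%N -> (k < n.+1)%N -> z k < z j.
  elim: k => // k IH; rewrite ltnS leq_eqVlt => /predU1P[->|jk] kn; first exact: zltS.
  exact: lt_trans (zltS _ kn) (IH jk (ltnW kn)).
have us : uniq s.
  apply/mkseq_uniqP => j k; rewrite !inE => jn kn zjk.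
  case: (ltngtP j k) => // jk; first by have := zlt _ _ jk kn; rewrite zjk ltxx.
  by have := zlt _ _ jk jn; rewrite zjk ltxx.
have rs : all (root q) s.
  by apply/allP => _ /mapP[k + ->]; rewrite mem_iota add0n => /zP[].
have s1 : all (fun z => z < 1) s.
  apply/allP => _ /mapP[k + ->]; rewrite mem_iota add0n => /zP[/andP[_ zx] _].
  by rewrite (lt_le_trans zx)// cos_le1.
have q1 : 0 < q.[1].
  by have := qx 0%N; rewrite expr0 mul1r /x mul0r cos0.
have q0 : q != 0 by apply: contraTneq q1 => ->; rewrite horner0 ltxx.
(* The degree equals the number of distinct roots found, so [q] is its leading coefficient times the
   product of the [X - z]. *)
have sq : size q = (size s).+1.
  apply/eqP; rewrite eqn_leq size_mkseq; apply/andP; split.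
    rewrite (leq_trans (size_polyD _ _))// geq_max size_chebyshev size_polyN.
    by rewrite (leq_trans (size_scale_leq _ _)).
  by have := max_poly_roots q0 rs us; rewrite size_mkseq.
have qE := all_roots_prod_XsubC sq rs (etrans (uniq_rootsE s) us).
have [P0 dP0] := horner_deriv_prod_ge0 s1.
(* The product is positive at 1, so [q(1) > 0] makes the leading coefficient positive. *)
have : 0 <= q^`().[1].
  move: q1; rewrite qE derivZ !hornerZ pmulr_lgt0// => l0.
  by rewrite mulr_ge0// ltW.
by rewrite derivB derivZ !hornerE deriv_chebyshev1 subr_ge0.
Qed.
End chebyshev_theory.

Lemma size_comp_poly_deg1 (R : idomainType) (p u : {poly R}) :
  (size u <= 2)%N -> (size (p \Po u) <= size p)%N.
Proof.
move=> u2; have [->|p0] := eqVneq p 0; first by rewrite comp_poly0.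
rewrite (leq_trans (size_comp_poly_leq _ _))//.
rewrite -[leqRHS]prednK ?size_poly_gt0// ltnS.
by rewrite -[leqRHS]muln1 leq_mul2l; case: (size u) u2 => [|[|[]]]; rewrite //= orbT.
Qed.

Lemma size_affine_poly (R : nzRingType) (a b : R) : (size (a%:P + b *: 'X)%R <= 2)%N.
Proof.
rewrite (leq_trans (size_polyD _ _))// geq_max (leq_trans (size_polyC_leq1 _))//=.
by rewrite (leq_trans (size_scale_leq _ _))// size_polyX.
Qed.

(** The affine map [u] from [[-1, 1]] onto [[a, b]] reverses orientation, so that the endpoint 1
    goes to [a]; the 2 comes from its slope. *)
Lemma markov_endpoint (R : realType) (n : nat) (p : {poly R}) (M a b : R) :
  (size p <= n.+1)%N -> 0 < M -> a < b ->
  (forall x, a <= x <= b -> `|p.[x]| <= M) ->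
  `|p^`().[a]| * (b - a) <= 2 * n%:R ^+ 2 * M.
Proof.
move=> sp M0 ab pM.
pose u : {poly R} := ((a + b) / 2)%:P + (- ((b - a) / 2)) *: 'X.
have pu (e : R) : `|e| = 1 -> e * p^`().[a] * (b - a) <= 2 * n%:R ^+ 2 * M.
  move=> e1; pose r := (- e / M) *: (p \Po u).
  have sr : (size r <= n.+1)%N.
    rewrite (leq_trans (size_scale_leq _ _))// (leq_trans _ sp)//.
    exact/size_comp_poly_deg1/size_affine_poly.
  have r1 x : -1 <= x <= 1 -> `|r.[x]| <= 1.
    move=> x1; rewrite hornerZ horner_comp normrM normrM normrN e1 mul1r.
    rewrite normfV (gtr0_norm M0) mulrC ler_pdivrMr// mul1r pM//.
    rewrite /u !hornerE; nra.
  have u1 : u.[1] = a by rewrite /u !hornerE; field.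
  have := markov_endpoint_le sr r1.
  rewrite derivZ deriv_comp hornerZ hornerM horner_comp u1.
  rewrite derivD derivC derivZ derivX add0r hornerZ hornerC mulr1 => H.
  have -> : e * p^`().[a] * (b - a) =
      - e / M * (p^`().[a] * - ((b - a) / 2)) * (2 * M).
    by field; rewrite gt_eqF.
  have -> : 2 * n%:R ^+ 2 * M = n%:R ^+ 2 * (2 * M) by ring.
  by rewrite ler_pM2r// mulr_gt0.
have h1 := pu 1 (normr1 _); have hN1 := pu (-1) (normrN1 _).
by have [/ger0_norm ->|/ltr0_norm ->] := lerP 0 p^`().[a]; lra.
Qed.

(** * Where a polynomial keeps half of its maximum *)

(** By the mean value theorem [p(s) - p(0) = s p'(c)] with [0 < c < s], and Markov's bound on
    [[c, 1]] gives [|p'(c)| (1 - c) <= 2 n^2 |p(0)|]. The change is at most [|p(0)| / 2] because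
    [4 n^2 s <= 1 - s <= 1 - c]. *)
Lemma half_max_unit_interval (R : realType) (n : nat) (p : {poly R}) (s : R) :
  (size p <= n.+1)%N -> (forall x, 0 <= x <= 1 -> `|p.[x]| <= `|p.[0]|) ->
  0 <= s -> s * (4 * n%:R ^+ 2 + 1) <= 1 -> `|p.[0]| / 2 <= `|p.[s]|.
Proof.
move=> sp pM; rewrite le_eqVlt => /predU1P[<- _|s0 sn].
  by have := normr_ge0 p.[0]; lra.
have n2 : 0 <= n%:R ^+ 2 :> R by rewrite exprn_ge0.
have s1 : s <= 1 by nra.
have [p0|p0] := eqVneq p.[0] 0; first by rewrite p0 normr0 mul0r.
have {}p0 : 0 < `|p.[0]| by rewrite normr_gt0.
have [c + pc] := poly_mvt p s0; rewrite in_itv/= => /andP[c0 cs].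
have c1 : c < 1 by lra.
have /(_ sp p0 c1) := @markov_endpoint R n p `|p.[0]| c 1.
have pM' x : c <= x <= 1 -> `|p.[x]| <= `|p.[0]| by move=> ?; apply: pM; lra.
move=> /(_ pM') H.
have : `|p.[s] - p.[0]| <= `|p.[0]| / 2.
  rewrite pc subr0 normrM (gtr0_norm s0).
  (* Degree 0 is separate, since the inequality is next multiplied by [4 n^2], which must be
     positive. *)
  case: n => [|n] in sp sn n2 H *.
    by rewrite (size1_polyC sp) derivC !hornerC normr0 mul0r divr_ge0.
  have n0 : 0 < n.+1%:R ^+ 2 :> R by rewrite exprn_gt0 ?ltr0n.
  rewrite -(ler_pM2l (mulr_gt0 (ltr0Sn R 3) n0)).
  rewrite (le_trans (_ : _ <= `|p^`().[c]| * (1 - c)))//; last by lra.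
  rewrite mulrCA ler_wpM2l//; lra.
have := ler_normD (p.[0] - p.[s]) p.[s]; rewrite subrK distrC; lra.
Qed.

(** The end [e] may lie on either side of [x0] or coincide with it, so both ends of an interval are
    covered. *)
Lemma half_max_segment (R : realType) (n : nat) (p : {poly R}) (x0 e x : R) :
  (size p <= n.+1)%N ->
  (forall t, 0 <= t <= 1 -> `|p.[x0 + t * (e - x0)]| <= `|p.[x0]|) ->
  (exists2 s, 0 <= s <= (4 * n%:R ^+ 2 + 1)^-1 & x = x0 + s * (e - x0)) ->
  `|p.[x0]| / 2 <= `|p.[x]|.
Proof.
move=> sp pM [s /andP[s0 sn] ->].
pose u := x0%:P + (e - x0) *: 'X.
have pu t : (p \Po u).[t] = p.[x0 + t * (e - x0)].
  by rewrite horner_comp /u !hornerE mulrC.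
have N0 : 0 < 4 * n%:R ^+ 2 + 1 :> R by rewrite ltr_wpDl// mulr_ge0// exprn_ge0.
have := @half_max_unit_interval R n (p \Po u) s.
rewrite !pu mul0r addr0; apply => //.
- exact: leq_trans (size_comp_poly_deg1 _ (size_affine_poly _ _)) sp.
- by move=> t t01; rewrite pu; exact: pM.
- by rewrite -ler_pdivlMr// mul1r.
Qed.

(** Supplies the parameter for [half_max_segment] from a distance and a sign condition. When
    [e = x0] the distance bound forces [x = x0]. *)
Lemma exists_convex_ratio (R : realFieldType) (x0 e x N : R) : 0 < N ->
  `|x - x0| * N <= `|e - x0| -> 0 <= (x - x0) * (e - x0) ->
  exists2 s, 0 <= s <= N^-1 & x = x0 + s * (e - x0).
Proof.
move=> N0; have [->|ex0] := eqVneq e x0.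
  rewrite subrr normr0 pmulr_lle0// normr_le0 subr_eq0 => /eqP-> _.
  by exists 0; rewrite ?lexx ?invr_ge0 ?(ltW N0)// mul0r addr0.
rewrite -subr_eq0 in ex0 => xN xe; exists ((x - x0) / (e - x0)).
  have s0 : 0 <= (x - x0) / (e - x0).
    have -> : (x - x0) / (e - x0) = (x - x0) * (e - x0) / (e - x0) ^+ 2 by field.
    by rewrite divr_ge0// sqr_ge0.
  rewrite s0/= -(ger0_norm s0) normrM normfV ler_pdivrMr ?normr_gt0//.
  by rewrite mulrC ler_pdivlMr.
by rewrite divfK// addrC subrK.
Qed.

(** * From pointwise bounds to integrals in one variable *)

Lemma measurable_norm_poly_powR (R : realType) (p : {poly R}) (q : R)
    (D : set (measurableTypeR R)) :
  measurable_fun D (fun t : measurableTypeR R => `|p.[t]| `^ q).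
Proof.
apply: (measurableT_comp (measurable_powR q)).
apply/measurableT_comp => //.
exact: measurable_poly.
Qed.

(** With [N = 4 r^2 + 1], [|p| >= M / 2] on a subinterval of length [L / N], so the integral is at
    least [(M / 2)^q L / N]. Since [2 (2 r^2 + 1) = N + 1], the constant times this is
    [L M^q (N + 1) / N], which is at least [L |p(0)|^q]. *)
Lemma endpoint_le_integral (R : realType) (r : nat) (p : {poly R}) (q L : R) :
  (size p <= r.+1)%N -> 0 < q -> 0 < L ->
  ((L * `|p.[0]| `^ q)%:E <= (2 `^ (q + 1) * (2 * r ^ 2 + 1)%:R)%:E *
    \int[lebesgue_measure]_(t in `[0%R, L]) (`|p.[t]| `^ q)%:E)%E.
Proof.
move=> sp q0 L0.
have [] := @EVT_max R (fun t => `|p.[t]|) 0 L (ltW L0).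
  apply: continuous_subspaceT => x; apply: continuous_comp.
    exact: continuous_horner.
  exact: norm_continuous.
move=> x0; rewrite in_itv/= => /andP[x00 x0L] pM.
pose M : R := `|p.[x0]|.
have {}pM (t : R) : 0 <= t <= L -> `|p.[t]| <= M.
  by move=> tL; apply: pM; rewrite in_itv.
set N : R := 4 * r%:R ^+ 2 + 1.
have N0 : 0 < N by rewrite ltr_wpDl// mulr_ge0// exprn_ge0.
have N1 : 1 <= N by rewrite lerDr mulr_ge0// exprn_ge0.
(* [[a, b]] is [[0, L]] contracted towards [x0] by the factor [1 / N], so its length is [L / N]
   wherever [x0] lies. *)
pose a := x0 - x0 / N; pose b := x0 + (L - x0) / N.
have a0 : 0 <= a by rewrite /a subr_ge0 ler_pdivrMr// ler_peMr.
have bL : b <= L by rewrite /b addrC -lerBrDr ler_pdivrMr// ler_peMr// subr_ge0.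
have ba : b - a = L / N by rewrite /a /b; field; rewrite gt_eqF.
have half (x : R) : a <= x <= b -> M / 2 <= `|p.[x]|.
  move=> /andP[ax xb]; have [xx0|x0x] := leP x x0.
    apply: (half_max_segment (e := 0) sp) => [t t01|]; first by apply: pM; nra.
    apply: exists_convex_ratio => //; last by nra.
    rewrite -ler_pdivlMr// sub0r normrN (ger0_norm x00) ler0_norm ?subr_le0//.
    by rewrite /a in ax; lra.
  apply: (half_max_segment (e := L) sp) => [t t01|]; first by apply: pM; nra.
  apply: exists_convex_ratio => //; last by nra.
  rewrite -ler_pdivlMr// !ger0_norm ?subr_ge0// ?(ltW x0x)//.
  by rewrite /b in xb; lra.
have M0 : 0 <= M := normr_ge0 _.
have : (((M / 2) `^ q * (L / N))%:E <=
    \int[lebesgue_measure]_(t in `[0%R, L]) (`|p.[t]| `^ q)%:E)%E.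
  apply: (@le_trans _ _
    (\int[lebesgue_measure]_(t in `[a, b]) (`|p.[t]| `^ q)%:E)%E).
    apply: (@le_trans _ _
      (\int[lebesgue_measure]_(t in `[a, b]) ((M / 2) `^ q)%:E)%E).
      rewrite integral_cst//= lebesgue_measure_itv/= lte_fin -subr_gt0 ba.
      by rewrite divr_gt0// -EFinD ba -EFinM lexx.
    apply: ge0_le_integral => //=.
    - by move=> x _; rewrite lee_fin powR_ge0.
    - by apply/measurable_EFinP; exact: measurable_norm_poly_powR.
    - move=> x; rewrite in_itv/= => /half Mx.
      by rewrite lee_fin ge0_ler_powR ?nnegrE ?divr_ge0// ltW.
  apply: ge0_subset_integral => //=.
  - by apply/measurable_EFinP; exact: measurable_norm_poly_powR.
  - move=> x /=; rewrite !in_itv/= => /andP[ax xb].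
    by rewrite (le_trans a0 ax) (le_trans xb bL).
have C0 : (0 <= (2 `^ (q + 1) * (2 * r ^ 2 + 1)%:R : R)%:E)%E.
  by rewrite lee_fin mulr_ge0// powR_ge0.
move=> /(lee_wpmul2l C0); apply: le_trans.
rewrite -EFinM lee_fin.
have p0M : `|p.[0]| `^ q <= M `^ q.
  by rewrite ge0_ler_powR ?nnegrE// ?(ltW q0)// pM// lexx ltW.
rewrite (le_trans (ler_wpM2l (ltW L0) p0M))//.
have -> : M `^ q = 2 `^ q * (M / 2) `^ q by rewrite -powRM ?divr_ge0// mulrC divfK.
rewrite powRD ?pnatr_eq0 ?implybT// powRr1//.
have -> : (2 * r ^ 2 + 1)%:R = (N + 1) / 2 :> R.
  by rewrite natrD natrM natrX /N; field.
have -> : 2 `^ q * 2 * ((N + 1) / 2) * ((M / 2) `^ q * (L / N)) =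
    L * (2 `^ q * (M / 2) `^ q) * ((N + 1) / N) by field; rewrite gt_eqF.
rewrite ler_peMr ?mulr_ge0 ?powR_ge0 ?(ltW L0)// ler_pdivlMr// mul1r lerDl//.
Qed.

Lemma measurable_weighted_norm_poly_powR (R : realType) (d : nat) (p : {poly R})
    (q : R) (D : set (measurableTypeR R)) :
  measurable_fun D (fun t : measurableTypeR R => ((1 - t) ^+ d * `|p.[t]| `^ q)%:E : \bar R).
Proof.
apply/measurable_EFinP/measurable_funM.
  by apply: measurable_funX; apply: measurable_funB.
exact: measurable_norm_poly_powR.
Qed.

(** The weight is at least [(1 - L)^d] on [[0, L]], where the unweighted bound applies. *)
Lemma endpoint_le_weighted_integral (R : realType) (d r : nat) (p : {poly R})
    (q L : R) :
  (size p <= r.+1)%N -> 0 < q -> 0 < L <= 1 ->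
  ((L * (1 - L) ^+ d * `|p.[0]| `^ q)%:E <=
    (2 `^ (q + 1) * (2 * r ^ 2 + 1)%:R)%:E *
    \int[lebesgue_measure]_(t in `[0%R, 1%R]) ((1 - t) ^+ d * `|p.[t]| `^ q)%:E)%E.
Proof.
move=> sp q0 /andP[L0 L1].
have d0 : 0 <= (1 - L) ^+ d by rewrite exprn_ge0// subr_ge0.
have C0 : (0 <= (2 `^ (q + 1) * (2 * r ^ 2 + 1)%:R : R)%:E)%E.
  by rewrite lee_fin mulr_ge0// powR_ge0.
have := endpoint_le_integral sp q0 L0.
move=> /(@lee_wpmul2l _ ((1 - L) ^+ d)%:E); rewrite lee_fin => /(_ d0).
rewrite -EFinM mulrA [_ * L]mulrC => /le_trans; apply.
rewrite muleCA lee_wpmul2l// -ge0_integralZl_EFin//=; last first.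
  by apply/measurable_EFinP; exact: measurable_norm_poly_powR.
set w := fun t : R => ((1 - t) ^+ d * `|p.[t]| `^ q)%:E.
have w0 t : t <= 1 -> (0 <= w t)%E.
  by move=> t1; rewrite lee_fin mulr_ge0 ?powR_ge0// exprn_ge0// subr_ge0.
apply: (@le_trans _ _ (\int[lebesgue_measure]_(t in `[0%R, L]) w t)%E).
  apply: ge0_le_integral => //=.
  - by move=> t _; rewrite -EFinM lee_fin mulr_ge0// powR_ge0.
  - by apply: measurable_funeM; apply/measurable_EFinP; exact: measurable_norm_poly_powR.
  - exact: measurable_weighted_norm_poly_powR.
  - move=> t; rewrite in_itv/= => /andP[t0 tL].
    rewrite -EFinM lee_fin ler_wpM2r ?powR_ge0// lerXn2r ?nnegrE ?subr_ge0//.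
      exact: le_trans L1.
    by rewrite lerD2l lerN2.
apply: ge0_subset_integral => //=.
- exact: measurable_weighted_norm_poly_powR.
- by move=> t; rewrite in_itv/= => /andP[_ t1]; exact: w0.
- move=> t /=; rewrite !in_itv/= => /andP[-> tL].
  exact: le_trans L1.
Qed.

(* The weight is at least [2 ^- d] on [[0, 1/2]]; for [d = 0] the whole interval
   can be used, whence the values of C_inv. *)
Lemma endpoint_le_C_inv (R : realType) (d r : nat) (p : {poly R}) (q : R) :
  (d <= 2)%N -> (size p <= r.+1)%N -> 0 < q ->
  ((`|p.[0]| `^ q)%:E <=
    (2 `^ (q + 1) * C_inv R d.+1 * (2 * r ^ 2 + 1)%:R)%:E *
    \int[lebesgue_measure]_(t in `[0%R, 1%R[) ((1 - t) ^+ d * `|p.[t]| `^ q)%:E)%E.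
Proof.
(* Omitting the null point [t = 1] matches Duffy's coordinates, which degenerate there. *)
move=> d2 sp q0; rewrite integral_itv_bndo_bndc; last first.
  exact: measurable_weighted_norm_poly_powR.
have [L L01 CE] : exists2 L : R, 0 < L <= 1 & C_inv R d.+1 * (L * (1 - L) ^+ d) = 1.
  case: d d2 => [|[|[|]]]// _.
  - by exists 1; rewrite ?lexx ?ltr01//= expr0 !mulr1.
  - by exists (2^-1); [lra|rewrite /=; field].
  - by exists (2^-1); [lra|rewrite /=; field].
have C0 : 0 <= C_inv R d.+1 by case: d d2 {CE} => [|[|[|]]].
have := endpoint_le_weighted_integral d sp q0 L01.
move=> /(@lee_wpmul2l _ (C_inv R d.+1)%:E); rewrite lee_fin => /(_ C0).
rewrite -EFinM mulrA CE mul1r muleA -EFinM.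
by rewrite mulrA [C_inv _ _ * _]mulrC.
Qed.

(** * Translation invariant measures *)

Lemma measurable_preimage d d' (T : measurableType d) (U : measurableType d')
    (f : T -> U) (A : set U) :
  measurable_fun setT f -> measurable A -> measurable (f @^-1` A).
Proof. by move=> mf mA; rewrite -[X in measurable X]setTI; exact: mf. Qed.

(** Both iterated integrals define measures that agree on rectangles, so uniqueness of the product
    of sigma-finite measures applies. *)
Lemma cavalieri d d' (T : measurableType d) (U : measurableType d')
    (R : realType) (m1 : {sigma_finite_measure set T -> \bar R})
    (m2 : {sigma_finite_measure set U -> \bar R}) (A : set (T * U)) :
  measurable A ->
  (\int[m1]_x m2 (xsection A x) = \int[m2]_y m1 (ysection A y))%E.
Proof.
move=> mA; apply: (@product_measure_unique _ _ _ _ _ m1 m2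
  (product_measure2 m1 m2)) => // X Y mX mY.
exact: product_measure2E.
Qed.

Lemma lebesgue_measure_shift (R : realType) (c : R) (A : set (measurableTypeR R)) :
  measurable A ->
  lebesgue_measure ((fun x : measurableTypeR R => c + x) @^-1` A) =
  lebesgue_measure A.
Proof.
have mf : measurable_fun setT
    ((fun x => c + x) : measurableTypeR R -> measurableTypeR R).
  exact: measurable_funD.
move=> mA; apply/esym.
pose mu := measure_function_pushforward__canonical__measure_function_Measure
  (@lebesgue_measure R) mf.
apply: (@lebesgue_measure_unique R mu) => // _ [[a b]] _ <-.
rewrite /mu/= /pushforward.
rewrite (_ : _ @^-1` _ = `]a - c, b - c]%classic); last first.
  by apply/seteqP; split=> x /=; rewrite !in_itv/= ltrBlDl lerBrDl.
rewrite !lebesgue_measure_itv/= !lte_fin ltrD2r -!EFinB.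
by congr (if _ then _%:E else _); ring.
Qed.

Section shift.
Variables (R : realType) (n : nat).
Implicit Types (s x y : Rn R n) (A B : set (Rn R n)).

Definition addRn x y : Rn R n := [tuple tnth x i + tnth y i | i < n].
Definition oppRn x : Rn R n := [tuple - tnth x i | i < n].

Lemma addRnC x y : addRn x y = addRn y x.
Proof. by apply: eq_from_tnth => i; rewrite !tnth_mktuple addrC. Qed.

Lemma addRnK x : cancel (addRn x) (addRn (oppRn x)).
Proof. by move=> y; apply: eq_from_tnth => i; rewrite !tnth_mktuple addKr. Qed.

Lemma measurable_addRn : measurable_fun setT (fun z : Rn R n * Rn R n => addRn z.1 z.2).
Proof.
apply/measurable_fun_tnthP => i.
rewrite (_ : _ \o _ = fun z : Rn R n * Rn R n => tnth z.1 i + tnth z.2 i).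
  apply: measurable_funD.
    exact: (measurableT_comp (measurable_tnth i) measurable_fst).
  exact: (measurableT_comp (measurable_tnth i) measurable_snd).
by apply/funext => z /=; rewrite tnth_mktuple.
Qed.

Lemma measurable_oppRn : measurable_fun setT oppRn.
Proof.
apply/measurable_fun_tnthP => i.
rewrite (_ : _ \o _ = fun x => - tnth x i).
  by apply: measurableT_comp => //; exact: measurable_tnth.
by apply/funext => z /=; rewrite tnth_mktuple.
Qed.

Definition shift_invariant (nu : set (Rn R n) -> \bar R) :=
  forall s A, measurable A -> nu (addRn s @^-1` A) = nu A.

(* Both sides are the integral of 1_A(x) 1_B(x + y) against nu(dx) lam(dy). *)
Lemma shift_invariant_swap (nu lam : {sigma_finite_measure set (Rn R n) -> \bar R}) A B :
  shift_invariant nu -> shift_invariant lam -> measurable A -> measurable B ->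
  (nu A * lam B = nu B * lam (oppRn @^-1` A))%E.
Proof.
move=> nuI lamI mA mB.
pose E := [set z : Rn R n * Rn R n | A z.1 /\ B (addRn z.1 z.2)].
(* [E'] is what [E] becomes when each slice at fixed [y] is translated by [y]. *)
pose E' := [set z : Rn R n * Rn R n | A (addRn (oppRn z.2) z.1) /\ B z.1].
have mE : measurable E.
  apply: measurableI; first exact: measurable_preimage measurable_fst mA.
  exact: measurable_preimage measurable_addRn mB.
have mE' : measurable E'.
  apply: measurableI; last exact: measurable_preimage measurable_fst mB.
  apply: (@measurable_preimage _ _ _ _ (fun z : Rn R n * Rn R n =>
    addRn (oppRn z.2) z.1)) => //.
  apply: (measurableT_comp measurable_addRn
    (g := fun z : Rn R n * Rn R n => (oppRn z.2, z.1))).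
  apply: measurable_fun_pair => //.
  exact: measurableT_comp measurable_oppRn measurable_snd.
have int1 (m : {measure set (Rn R n) -> \bar R}) X (c : \bar R) : measurable X ->
    (\int[m]_x (if x \in X then c else 0) = m X * c)%E.
  move=> mX; rewrite muleC -integral_cst// [RHS]integral_mkcond.
  by apply: eq_integral => x _; rewrite patchE.
transitivity (\int[nu]_x lam (xsection E x))%E.
  rewrite -int1//; apply: eq_integral => x _.
  case: ifPn => [/set_mem Ax|/negP xA].
    rewrite -(lamI x B mB); congr (lam _); apply/seteqP; split => y /=.
      by rewrite /xsection/= inE.
    by rewrite /xsection/= inE => -[].
  rewrite (_ : xsection E x = set0) ?measure0//; apply/seteqP; split => // y.
  by rewrite /xsection/= inE => -[/mem_set].
(* Exchanging the order lets the invariance of [nu] act at each fixed [y]. *)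
rewrite cavalieri//.
transitivity (\int[lam]_y nu (ysection E' y))%E.
  apply: eq_integral => y _; rewrite -(nuI y (ysection E' y)); last first.
    exact: measurable_ysection.
  congr (nu _); apply/seteqP; split => x /=; rewrite /ysection/= !inE /E /E'/=.
    by rewrite addRnK addRnC.
  by rewrite addRnK [addRn y x]addRnC.
(* In the original order again, the slice of [E'] over a point of [B] is a translate of the
   reflection of [A]. *)
rewrite -cavalieri// -int1//; apply: eq_integral => x _.
case: ifPn => [/set_mem Bx|/negP xB].
  rewrite -(lamI (oppRn x)); last exact: measurable_preimage measurable_oppRn mA.
  congr (lam _); apply/seteqP; split => y /=; rewrite /xsection/= inE /E'/=.
    move=> [+ _]; congr A; apply: eq_from_tnth => i; rewrite !tnth_mktuple; ring.
  move=> H; split => //; move: H; congr A.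
  apply: eq_from_tnth => i; rewrite !tnth_mktuple; ring.
rewrite (_ : xsection E' x = set0) ?measure0//; apply/seteqP; split => // y.
by rewrite /xsection/= inE => -[_ /mem_set].
Qed.

End shift.

Lemma measurable_preimage_cons (R : realType) (n : nat) (A : set (Rn R n.+1)) :
  measurable A -> measurable (cons_Rn @^-1` A).
Proof. exact: measurable_preimage measurable_cons_Rn. Qed.

Lemma lebesgueS (R : realType) (n : nat) (A : set (Rn R n.+1)) :
  lebesgue R n.+1 A =
  (\int[lebesgue_measure]_t lebesgue R n (xsection (cons_Rn @^-1` A) t))%E.
Proof. by []. Qed.

Lemma ge0_integral_lebesgueS (R : realType) (n : nat) (f : Rn R n.+1 -> \bar R) :
  measurable_fun setT f -> (forall x, 0 <= f x)%E ->
  (\int[lebesgue R n.+1]_x f x =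
   \int[lebesgue_measure]_t \int[lebesgue R n]_y f (cons_Rn (t, y)))%E.
Proof.
move=> mf f0.
rewrite (@ge0_integral_pushforward _ _ _ _ _ _ measurable_cons_Rn
  (lebesgue_measure \x lebesgue R n)%E setT f)//=.
rewrite preimage_setT (@fubini_tonelli1 _ _ _ _ _ _ _ (f \o cons_Rn))//.
  exact: measurableT_comp mf measurable_cons_Rn.
by move=> z; exact: f0.
Qed.

Lemma addRn_cons (R : realType) (n : nat) (s : Rn R n.+1) (t : R) (y : Rn R n) :
  addRn s (cons_Rn (t, y)) = cons_Rn (thead s + t, addRn [tuple of behead s] y).
Proof.
apply: eq_from_tnth => i; rewrite tnth_mktuple.
case: (unliftP ord0 i) => [j|] ->; last by rewrite !tnth0.
rewrite !tnthS tnth_mktuple tnth_behead; congr (tnth s _ + _).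
by apply/val_inj; rewrite /= inordK ?ltnS.
Qed.

(** Induction on the dimension: the tail of [s] translates each slice, its head translates the
    slicing coordinate. *)
Lemma lebesgue_shift_invariant (R : realType) (n : nat) :
  shift_invariant (lebesgue R n).
Proof.
elim: n => [|n IH] s A mA.
  by congr (lebesgue R 0 _); apply/seteqP; split=> x /=; rewrite [addRn s x]tuple0 [x]tuple0.
rewrite !lebesgueS; pose g := fun t : measurableTypeR R =>
  lebesgue R n (xsection (cons_Rn @^-1` A) t).
transitivity (\int[lebesgue_measure]_t g (thead s + t)%R)%E.
  apply: eq_integral => t _; rewrite /g -[RHS](IH [tuple of behead s]); last first.
    by apply: measurable_xsection; exact: measurable_preimage_cons.
  congr (lebesgue R n _); apply/seteqP; split => y; rewrite /xsection/= !inE/=.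
    by rewrite addRn_cons.
  by rewrite addRn_cons.
have mg : measurable_fun setT g.
  exact: measurable_fun_xsection (measurable_preimage_cons mA).
have mf : measurable_fun setT
    ((fun x => thead s + x) : measurableTypeR R -> measurableTypeR R).
  exact: measurable_funD.
have := @ge0_integral_pushforward _ _ _ _ R _ mf lebesgue_measure setT g measurableT mg.
rewrite preimage_setT/= => <-//.
by apply: eq_measure_integral => B mB _; exact: lebesgue_measure_shift.
Qed.

Definition unit_cube (R : realType) (n : nat) : set (Rn R n) :=
  [set x | forall i, `[0%R, 1%R]%classic (tnth x i)].

Lemma measurable_box (R : realType) (n : nat) (A : 'I_n -> set (measurableTypeR R)) :
  (forall i, measurable (A i)) -> measurable [set x : Rn R n | forall i, A i (tnth x i)].
Proof.
move=> mA; rewrite (_ : [set _ | _] = \bigcap_(i in [set: 'I_n])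
    ((fun x : Rn R n => tnth x i) @^-1` A i)).
  apply: fin_bigcap_measurable => // i _.
  exact: measurable_preimage (measurable_tnth i) (mA i).
by apply/seteqP; split=> [x xA i _|x xA i]; apply: xA.
Qed.

Lemma measurable_unit_cube (R : realType) (n : nat) : measurable (@unit_cube R n).
Proof. by apply: (measurable_box (A := fun=> `[0%R, 1%R]%classic)). Qed.

Lemma lebesgue_unit_cube (R : realType) (n : nat) :
  lebesgue R n (@unit_cube R n) = 1%E.
Proof.
rewrite (lebesgue_box (A := fun=> `[0%R, 1%R]%classic))// big1// => i _.
by rewrite lebesgue_measure_itv/= lte_fin ltr01 sube0.
Qed.

(** Lebesgue measure is compared with itself on [A] and the unit cube; this removes the reflection
    from [shift_invariant_swap]. *)
Lemma lebesgue_opp (R : realType) (n : nat) (A : set (Rn R n)) : measurable A ->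
  lebesgue R n (@oppRn R n @^-1` A) = lebesgue R n A.
Proof.
move=> mA; have := shift_invariant_swap (@lebesgue_shift_invariant R n)
  (@lebesgue_shift_invariant R n) mA (@measurable_unit_cube R n).
by rewrite lebesgue_unit_cube mule1 mul1e.
Qed.

(** Comparing [A] with the unit cube [Q] in [shift_invariant_swap] identifies the factor as
    [nu Q]. *)
Lemma shift_invariant_lebesgue (R : realType) (n : nat)
    (nu : {sigma_finite_measure set (Rn R n) -> \bar R}) :
  shift_invariant nu -> nu setT != 0%E ->
  exists2 c : R, 0 < c & forall A, measurable A -> nu A = (c%:E * lebesgue R n A)%E.
Proof.
move=> nuI nuT0; set Q := @unit_cube R n.
have nuE A : measurable A -> nu A = (nu Q * lebesgue R n A)%E.
  move=> mA; have := shift_invariant_swap nuI (@lebesgue_shift_invariant R n)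
    mA (@measurable_unit_cube R n).
  by rewrite lebesgue_unit_cube mule1 lebesgue_opp.
have nuQ0 : (0 < nu Q)%E.
  rewrite lt_neqAle measure_ge0 andbT eq_sym; apply: contraNneq nuT0 => nuQ.
  by rewrite nuE// nuQ mul0e.
(* If [nu Q] were infinite, every set of finite [nu]-measure would be Lebesgue null; but countably
   many of them cover the space, hence the unit cube. *)
have nuQoo : (nu Q < +oo)%E.
  rewrite ltNge leye_eq; apply/eqP => nuQ.
  have /sigma_finiteP[F [TF _ Foo]] := sigma_finiteT nu.
  have F0 k : lebesgue R n (F k) = 0%E.
    have [mF Fk] := Foo k; apply/eqP; apply: contraTT Fk => F0.
    rewrite -[ltLHS]/(nu (F k)) nuE// nuQ gt0_mulye ?ltxx//.
    by rewrite lt_neqAle eq_sym F0 measure_ge0.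
  have : (1 <= lebesgue R n (\bigcup_k F k))%E.
    rewrite -TF -(lebesgue_unit_cube R n); apply: le_measure; rewrite ?inE//.
    exact: measurable_unit_cube.
  apply/negP; rewrite -ltNge (@le_lt_trans _ _ 0%E)//.
  rewrite (le_trans (@measure_sigma_subadditive _ _ _ (lebesgue R n) _ F _ _ _))//.
  - by move=> k; have [] := Foo k.
  - by apply: bigcupT_measurable => k; have [] := Foo k.
  - by rewrite eseries0// => k _ _; exact: F0.
exists (fine (nu Q)); first by rewrite fine_gt0// nuQ0.
by move=> A mA; rewrite nuE// fineK// ge0_fin_numE// ltW.
Qed.

(* The image of Lebesgue measure under such a bijection is translation invariant. *)
Lemma lebesgue_equivariant (R : realType) (n : nat) (f g : Rn R n -> Rn R n) :
  measurable_fun setT f -> measurable_fun setT g -> cancel f g -> cancel g f ->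
  (forall s, exists s', forall x, f (addRn s' x) = addRn s (f x)) ->
  exists2 c : R, 0 < c & forall A, measurable A ->
    lebesgue R n (f @^-1` A) = (c%:E * lebesgue R n A)%E.
Proof.
move=> mf mg fK gK fE.
pose nu := measure_function_pushforward__canonical__measure_function_Measure
  (lebesgue R n) mf.
have sf : sigma_finite setT nu.
  have [F TF Foo] := sigma_finiteT (lebesgue R n).
  exists (fun k => g @^-1` F k).
    apply/seteqP; split=> // x _.
    by have [k _ Fk] : (\bigcup_n F n) (g x) by [rewrite -TF]; exists k.
  move=> k; have [mF Fk] := Foo k; split; first exact: measurable_preimage mg mF.
  rewrite /nu/= /pushforward -comp_preimage (_ : g \o f = id) ?preimage_id//.
  exact/funext.
pose nu' : {sigma_finite_measure set (Rn R n) -> \bar R} :=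
  HB.pack (nu : set (Rn R n) -> \bar R) (Measure.on nu)
    (Measure_isSigmaFinite.Build _ _ _ nu sf).
have nuI : shift_invariant nu'.
  move=> s A mA; have [s' fs] := fE s.
  rewrite /nu'/= /pushforward -[RHS](lebesgue_shift_invariant s'); last first.
    exact: measurable_preimage mf mA.
  by congr (lebesgue R n _); apply/seteqP; split => x /=; rewrite fs.
apply: (shift_invariant_lebesgue nuI); rewrite /nu'/= /pushforward preimage_setT.
rewrite gt_eqF// (@lt_le_trans _ _ 1%E)// -(lebesgue_unit_cube R n).
apply: le_measure; rewrite ?inE//; exact: measurable_unit_cube.
Qed.

(** * Duffy's coordinates *)

(** Change of variables with an abstract factor [c] in place of a Jacobian. *)
Lemma ge0_integral_comp_proportional d d' (T : measurableType d)
    (U : measurableType d') (R : realType) (mu : {measure set T -> \bar R})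
    (nu : {measure set U -> \bar R}) (phi : T -> U) (c : R) (D : set U)
    (f : U -> \bar R) :
  measurable_fun setT phi -> 0 <= c ->
  (forall A, measurable A -> mu (phi @^-1` A) = (c%:E * nu A)%E) ->
  measurable D -> measurable_fun D f -> (forall x, D x -> 0 <= f x)%E ->
  (\int[mu]_(x in phi @^-1` D) f (phi x) = c%:E * \int[nu]_(y in D) f y)%E.
Proof.
move=> mphi c0 muE mD mf f0.
rewrite -[LHS](ge0_integral_pushforward mphi mu mD mf); last first.
  by move=> y /set_mem; exact: f0.
rewrite -(ge0_integral_mscale nu mD (NngNum c0) mf f0).
by apply: eq_measure_integral => A mA _; exact: muE.
Qed.

Section scaling.
Variables (R : realType) (n : nat).
Implicit Types (s : R) (x : Rn R n).

Definition scaleRn s x : Rn R n := [tuple s * tnth x i | i < n].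

Lemma measurable_scaleRn :
  measurable_fun setT (fun z : measurableTypeR R * Rn R n => scaleRn z.1 z.2).
Proof.
apply/measurable_fun_tnthP => i.
rewrite (_ : _ \o _ = fun z : measurableTypeR R * Rn R n => z.1 * tnth z.2 i).
  apply: measurable_funM => //.
  exact: (measurableT_comp (measurable_tnth i) measurable_snd).
by apply/funext => z /=; rewrite tnth_mktuple.
Qed.

Lemma measurable_scaleRn1 s : measurable_fun setT (scaleRn s).
Proof.
apply: (measurableT_comp measurable_scaleRn (g := fun x => (s, x))).
by apply: measurable_fun_pair; [exact: measurable_cst|exact: measurable_id].
Qed.

Lemma scaleRnK s : s != 0 -> cancel (scaleRn s) (scaleRn s^-1).
Proof.
by move=> s0 x; apply: eq_from_tnth => i; rewrite !tnth_mktuple mulKf.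
Qed.

Lemma lebesgue_scale s (A : set (Rn R n)) : 0 < s -> measurable A ->
  lebesgue R n (scaleRn s @^-1` A) = ((s ^- n)%:E * lebesgue R n A)%E.
Proof.
move=> s0 mA; have sN0 : s != 0 by rewrite gt_eqF.
have [] := @lebesgue_equivariant R n (scaleRn s) (scaleRn s^-1).
- exact: measurable_scaleRn1.
- exact: measurable_scaleRn1.
- exact: scaleRnK.
- by move=> x; rewrite -{1}[s]invrK scaleRnK// invr_eq0.
- move=> t; exists (scaleRn s^-1 t) => x; apply: eq_from_tnth => i.
  by rewrite !tnth_mktuple mulrDr mulVKf.
move=> c c0 cE; rewrite cE//; congr (_ * _)%E.
(* The factor is read off on the unit cube, whose preimage is a cube of side [s^-1]. *)
have := cE _ (@measurable_unit_cube R n); rewrite lebesgue_unit_cube mule1 => <-.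
rewrite (_ : _ @^-1` _ = [set x | forall i, `[0%R, s^-1]%classic (tnth x i)]).
  rewrite (lebesgue_box (A := fun=> `[0%R, s^-1]%classic))//.
  rewrite (eq_bigr (fun=> (s^-1)%:E)); last first.
    by move=> i _; rewrite lebesgue_measure_itv/= lte_fin invr_gt0 s0 sube0.
  by rewrite prodEFin prodr_const card_ord exprVn.
apply/seteqP; split => x /= H i; have := H i; rewrite tnth_mktuple/= !in_itv/=.
  by rewrite pmulr_rge0// -ler_pdivlMl// mulr1.
by rewrite pmulr_rge0// -ler_pdivlMl// mulr1.
Qed.

Lemma ge0_integral_scale s (f : Rn R n -> \bar R) : 0 < s ->
  measurable_fun setT f -> (forall x, 0 <= f x)%E ->
  (\int[lebesgue R n]_x f x = (s ^+ n)%:E * \int[lebesgue R n]_x f (scaleRn s x))%E.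
Proof.
move=> s0 mf f0.
have := @ge0_integral_comp_proportional _ _ _ _ R (lebesgue R n) (lebesgue R n)
  (scaleRn s) (s ^- n) setT f (@measurable_scaleRn1 s).
rewrite preimage_setT => ->//.
- by rewrite muleA -EFinM divff ?mul1e// expf_neq0// gt_eqF.
- by rewrite invr_ge0 exprn_ge0// ltW.
- by move=> A mA; exact: lebesgue_scale.
Qed.

End scaling.

Definition std_simplex (R : realType) (n : nat) : set (Rn R n) :=
  [set x | (forall i, 0 <= tnth x i) /\ \sum_i tnth x i <= 1].

Lemma measurable_std_simplex (R : realType) (n : nat) : measurable (@std_simplex R n).
Proof.
rewrite (_ : @std_simplex R n =
    [set x : Rn R n | forall i, `[0%R, +oo[%classic (tnth x i)]
    `&` ((fun x : Rn R n => \sum_i tnth x i) @^-1` `]-oo, 1%R])); last first.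
  apply/seteqP; split => x /=; rewrite in_itv/= => -[x0 x1]; split => // i.
    by rewrite in_itv/= x0.
  by have := x0 i; rewrite in_itv/= andbT.
apply: measurableI; first exact: (measurable_box (A := fun=> `[0%R, +oo[%classic)).
apply: measurable_preimage; last exact: measurable_itv.
by apply: measurable_sum => i; exact: measurable_tnth.
Qed.

Lemma std_simplex_cons (R : realType) (n : nat) (t : R) (z : Rn R n) : t < 1 ->
  std_simplex (cons_Rn (t, scaleRn (1 - t) z)) <-> 0 <= t /\ std_simplex z.
Proof.
move=> t1; have t1' : 0 < 1 - t by rewrite subr_gt0.
have sumE : \sum_i tnth (cons_Rn (t, scaleRn (1 - t) z)) i =
    t + (1 - t) * \sum_i tnth z i.
  rewrite big_ord_recl tnth0; congr (_ + _); rewrite mulr_sumr.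
  by apply: eq_bigr => i _; rewrite tnthS tnth_mktuple.
have le1 : (t + (1 - t) * \sum_i tnth z i <= 1) = (\sum_i tnth z i <= 1).
  by rewrite -lerBrDl -[X in _ <= X]mulr1 ler_pM2l.
split=> [[H]|[t0 [z0 z1]]].
  rewrite sumE le1 => z1; split; first by have := H ord0; rewrite tnth0.
  split=> // i; have := H (lift ord0 i); rewrite tnthS tnth_mktuple.
  by rewrite pmulr_rge0.
split; last by rewrite sumE le1.
move=> i; case: (unliftP ord0 i) => [j|] ->; last by rewrite tnth0.
by rewrite tnthS tnth_mktuple mulr_ge0// ltW.
Qed.

Section duffy.
Variables (R : realType) (n : nat) (f : Rn R n.+1 -> \bar R).
Hypotheses (mf : measurable_fun setT f) (f0 : forall x, (0 <= f x)%E).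

(** [f] in Duffy's coordinates, times their Jacobian [(1 - t)^n]. *)
Let h (w : measurableTypeR R * Rn R n) :=
  (((1 - w.1) ^+ n)%:E * f (cons_Rn (w.1, scaleRn (1 - w.1) w.2)))%E.

Let measurable_h_restrict (D : set (measurableTypeR R * Rn R n)) :
  measurable D -> measurable_fun setT (h \_ D).
Proof.
move=> mD; apply/(measurable_restrictT _ _).1 => //; apply: measurable_funTS.
have m1 : measurable_fun setT (fun w : measurableTypeR R * Rn R n => 1 - w.1).
  by apply: measurable_funB.
apply: emeasurable_funM; first by apply/measurable_EFinP; exact: measurable_funX.
apply: measurableT_comp mf _; apply: measurableT_comp measurable_cons_Rn _.
apply: measurable_fun_pair => //.
apply: (measurableT_comp (@measurable_scaleRn R n)
  (g := fun w : measurableTypeR R * Rn R n => (1 - w.1, w.2))).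
exact: measurable_fun_pair.
Qed.

(** Beyond [t = 1] the Jacobian can be negative, hence the restriction. *)
Let h_restrict_ge0 (D : set (measurableTypeR R * Rn R n)) w :
  D `<=` `[0%R, 1%R[%classic `*` setT -> (0 <= (h \_ D) w)%E.
Proof.
move=> D01; rewrite patchE; case: ifPn => // /set_mem /D01[/=].
rewrite in_itv/= => /andP[t0 t1] _.
by rewrite mule_ge0// lee_fin exprn_ge0// subr_ge0 ltW.
Qed.

Lemma measurable_integral_duffy (D : set (Rn R n)) :
  measurable_fun D (fun z => \int[lebesgue_measure]_(t in `[0%R, 1%R[)
    (((1 - t) ^+ n)%:E * f (cons_Rn (t, scaleRn (1 - t) z))))%E.
Proof.
apply: measurable_funTS.
pose D01 : set (measurableTypeR R * Rn R n) := `[0%R, 1%R[%classic `*` setT.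
rewrite (_ : (fun z => _) = fubini_G lebesgue_measure (h \_ D01)).
  apply: measurable_fun_fubini_tonelli_G.
    by apply: measurable_h_restrict; exact: measurableX.
  by move=> w; exact: h_restrict_ge0.
apply/funext => z; rewrite /fubini_G [LHS]integral_mkcond.
apply: eq_integral => t _; rewrite !patchE.
congr (if _ then _ else _); apply/idP/idP => /set_mem H; apply/mem_set.
  by split.
by have [] := H.
Qed.

(* The slice at height [t] is a copy of the base scaled by [1 - t]. *)
Lemma ge0_integral_duffy :
  (\int[lebesgue R n.+1]_(x in @std_simplex R n.+1) f x =
   \int[lebesgue R n]_(z in @std_simplex R n) \int[lebesgue_measure]_(t in `[0%R, 1%R[)
     (((1 - t) ^+ n)%:E * f (cons_Rn (t, scaleRn (1 - t) z))))%E.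
Proof.
rewrite integral_mkcond.
have mS := @measurable_std_simplex R n; have mS' := @measurable_std_simplex R n.+1.
set fS := f \_ _.
have mfS : measurable_fun setT fS.
  by apply/(measurable_restrictT _ _).1 => //; exact: measurable_funTS.
have fS0 x : (0 <= fS x)%E by rewrite /fS patchE; case: ifP.
rewrite ge0_integral_lebesgueS//.
pose G t := (\int[lebesgue R n]_y fS (cons_Rn (t, y)))%E.
have mG : measurable_fun setT G.
  apply: (@measurable_fun_fubini_tonelli_F _ _ _ _ _ (lebesgue R n) (fS \o cons_Rn)).
    exact: measurableT_comp mfS measurable_cons_Rn.
  by move=> z; exact: fS0.
pose D : set (measurableTypeR R * Rn R n) :=
  `[0%R, 1%R[%classic `*` @std_simplex R n.
have mhD : measurable_fun setT (h \_ D).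
  by apply: measurable_h_restrict; exact: measurableX.
have hD0 w : (0 <= (h \_ D) w)%E by apply: h_restrict_ge0 => -[t z] [].
transitivity (\int[lebesgue_measure]_t \int[lebesgue R n]_z (h \_ D) (t, z))%E.
  (* Only heights in [[0, 1]] meet the simplex, and the single height 1 is null. *)
  transitivity (\int[lebesgue_measure]_(t in `[0%R, 1%R[) G t)%E.
    rewrite integral_itv_bndo_bndc; last exact: measurable_funTS.
    rewrite [RHS]integral_mkcond; apply: eq_integral => t _.
    rewrite patchE; case: ifPn => // /negP t01.
    rewrite integral0_eq// => y _; rewrite /fS patchE; case: ifPn => // /set_mem[H1 H2].
    exfalso; apply: t01; apply/mem_set; rewrite /= in_itv/=.
    have := H1 ord0; rewrite tnth0 => ->/=; rewrite (le_trans _ H2)//.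
    by rewrite big_ord_recl tnth0 lerDl sumr_ge0.
  rewrite integral_mkcond; apply: eq_integral => t _.
  rewrite patchE; case: ifPn => [/set_mem|/negP tN].
    rewrite /= in_itv/= => /andP[t0 t1].
    (* Substituting [y = (1 - t) z] makes every slice the same simplex and produces the Jacobian. *)
    rewrite /G (@ge0_integral_scale _ _ (1 - t))//; last 2 first.
    - by rewrite subr_gt0.
    - apply: (measurableT_comp mfS); apply: (measurableT_comp measurable_cons_Rn).
      by apply: measurable_fun_pair => //; exact: measurable_cst.
    rewrite -ge0_integralZl_EFin//; last 2 first.
    - apply: (measurableT_comp mfS); apply: (measurableT_comp measurable_cons_Rn).
      by apply: measurable_fun_pair; [exact: measurable_cst|exact: measurable_scaleRn1].
    - by rewrite exprn_ge0// subr_ge0 ltW.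
    apply: eq_integral => z _; rewrite /fS !patchE /h/=.
    have e := std_simplex_cons z t1.
    case: ifPn => [/set_mem /e[_ Sz]|/negP NS].
      rewrite ifT//; apply/mem_set; split => //=; by rewrite in_itv/= t0.
    rewrite mule0 ifF//; apply/negP => /set_mem[/= _ Sz]; apply: NS.
    by apply/mem_set/e.
  rewrite integral0_eq// => z _; rewrite patchE ifF//.
  by apply/negP => /set_mem [/= H _]; apply: tN; exact: mem_set.
(* Tonelli makes [t] the inner variable, so that each inner integral runs along one segment towards
   the apex. *)
rewrite (@fubini_tonelli _ _ _ _ _ lebesgue_measure (lebesgue R n) (h \_ D))//.
rewrite [RHS]integral_mkcond; apply: eq_integral => z _.
rewrite [RHS]patchE; case: ifPn => [/set_mem Sz|/negP NS].
  rewrite [RHS]integral_mkcond; apply: eq_integral => t _; rewrite !patchE.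
  congr (if _ then _ else _); apply/idP/idP => /set_mem.
    by move=> [/= H _]; exact: mem_set.
  by move=> H; apply/mem_set; split.
rewrite integral0_eq// => t _; rewrite patchE ifF//.
by apply/negP => /set_mem [/= _ H]; apply: NS; exact: mem_set.
Qed.

End duffy.

(** The fundamental theorem with the primitive [- (1 - t)^(n+1) / (n+1)]. *)
Lemma integral_1BX (R : realType) (n : nat) :
  (\int[lebesgue_measure]_(t in `[0%R, 1%R[) ((1 - t : R) ^+ n)%:E =
   ((n.+1%:R)^-1 : R)%:E)%E.
Proof.
pose P : {poly R} := - (n.+1%:R)^-1 *: (1 - 'X) ^+ n.+1.
have n0 : n.+1%:R != 0 :> R by rewrite pnatr_eq0.
have P' : P^`() = (1 - 'X) ^+ n.
  rewrite /P derivZ deriv_exp derivB derivC derivX sub0r mulN1r -scalerMnr scalerMnl.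
  by rewrite -mulr_natr mulNr mulVf// scaleN1r opprK.
have P'E (t : R) : P^`().[t] = (1 - t) ^+ n by rewrite P' !hornerE.
rewrite integral_itv_bndo_bndc; last first.
  apply/measurable_EFinP; apply: measurable_funX; exact: measurable_funB.
under eq_integral do rewrite -P'E.
rewrite (@continuous_FTC2 _ _ (horner P)).
- by rewrite /P !hornerE subrr subr0 expr1n expr0n mulr0 mulr1 EFinN oppeK add0e.
- exact: ltr01.
- exact/continuous_subspaceT/continuous_horner.
- split=> [x _| |]; first exact: derivable_horner.
  + by apply: cvg_at_right_filter; exact: continuous_horner.
  + by apply: cvg_at_left_filter; exact: continuous_horner.
- by move=> x _; rewrite -derivE.
Qed.

(** Duffy's formula for the constant 1; the ratio [1 / (n+1)] is the source of the dimension in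
    [d |K|]. *)
Lemma lebesgue_std_simplexS (R : realType) (n : nat) :
  (lebesgue R n.+1 (@std_simplex R n.+1) =
   ((n.+1%:R)^-1)%:E * lebesgue R n (@std_simplex R n))%E.
Proof.
rewrite -[LHS]mul1e -integral_cst//; last exact: measurable_std_simplex.
rewrite ge0_integral_duffy//.
rewrite -integral_cst//; last exact: measurable_std_simplex.
apply: eq_integral => z _; rewrite -integral_1BX; apply: eq_integral => t _.
by rewrite mule1.
Qed.

(** This volume occurs in both [|F|] and [|K|]; finite and nonzero, it cancels in their ratio. *)
Lemma lebesgue_std_simplex_gt0 (R : realType) (n : nat) :
  exists2 c : R, 0 < c & lebesgue R n (@std_simplex R n) = c%:E.
Proof.
elim: n => [|n [c c0 cE]].
  exists 1 => //; rewrite /= diracE mem_set//.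
  by split=> [[]//|]; rewrite big_ord0.
exists ((n.+1%:R)^-1 * c); first by rewrite mulr_gt0// invr_gt0.
by rewrite lebesgue_std_simplexS cE.
Qed.

(** * Affine charts of simplices *)

(** Substituting univariate polynomials of degree at most 1 for the variables turns a monomial of
    degree [k] into a polynomial of degree at most [k]. *)
Lemma meval_line (R : realType) (n r : nat) (p : mpoly.mpoly n R)
    (x e : 'I_n -> R) : (mpoly.msize p <= r.+1)%N ->
  exists2 g : {poly R}, (size g <= r.+1)%N &
    forall t, g.[t] = mpoly.meval (fun j => x j + e j * t) p.
Proof.
move=> pr; pose l j := (x j)%:P + e j *: 'X.
exists (mpoly.mmap (@polyC R) l p).
  apply: (leq_trans (size_sum _ _ _)); apply/bigmax_leqP_seq => m mp _.
  rewrite mul_polyC (leq_trans (size_scale_leq _ _))//.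
  apply: (@leq_trans (mpoly.mdeg m).+1); last first.
    exact: leq_trans (mpoly.msize_mdeg_lt mp) pr.
  rewrite mpoly.mdegE /mpoly.mmap1.
  elim/big_rec2: _ => [|j k g _ IH]; first by rewrite size_poly1.
  rewrite (leq_trans (size_polyMleq _ _))//.
  have lk : (size (l j ^+ (m j)) <= (m j).+1)%N.
    rewrite (leq_trans (size_poly_exp_leq _ _))// ltnS.
    rewrite -[leqRHS]mul1n leq_mul2r; apply/orP; right.
    by have := size_affine_poly (x j) (e j); rewrite -/(l j); case: (size _) => [|[|[]]].
  by rewrite -subn1 leq_subLR (leq_trans (leq_add lk IH))// addSn addnS add1n.
move=> t; rewrite /mpoly.mmap /mpoly.meval /mpoly.mmap horner_sum.
apply: eq_bigr => m _; rewrite hornerM hornerC; congr (_ * _).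
rewrite horner_prod; apply: eq_bigr => j _.
by rewrite horner_exp /l !hornerE.
Qed.

Lemma measurable_meval (R : realType) (n : nat) (p : mpoly.mpoly n R) :
  measurable_fun setT (fun x : Rn R n => mpoly.meval (tnth x) p).
Proof.
rewrite /mpoly.meval /mpoly.mmap; apply: measurable_sum => m.
apply: measurable_funM; first exact: measurable_cst.
rewrite /mpoly.mmap1; apply: measurable_prod => j _.
by apply: measurable_funX; exact: measurable_tnth.
Qed.

Section charts.
Variables (R : realType) (m d : nat).
Implicit Types (a : 'I_m.+1 -> Rn R d).

Lemma affine_chartE a (y : Rn R m) j : tnth (affine_chart a y) j =
  (1 - \sum_k tnth y k) * tnth (a ord0) j +
  \sum_k tnth y k * tnth (a (lift ord0 k)) j.
Proof.
rewrite tnth_mktuple; under eq_bigr do rewrite mxE mulrBr.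
rewrite sumrB -mulr_suml; ring.
Qed.

(** The parameters are the barycentric weights of all vertices but the first, whose weight is the
    complement to 1. *)
Lemma image_affine_chart a : affine_chart a @` @std_simplex R m = simplex a.
Proof.
apply/seteqP; split => [_ [y [y0 y1] <-]|x [w [w0 w1 wx]]].
  exists (fun k => if unlift ord0 k is Some k' then tnth y k' else 1 - \sum_k tnth y k).
  split.
  - by move=> k; case: unliftP => [k' _|_]; rewrite ?y0 ?subr_ge0.
  - rewrite big_ord_recl unlift_none [X in _ + X](eq_bigr (tnth y)) ?subrK// => k _.
    by rewrite liftK.
  - move=> j; rewrite affine_chartE [RHS]big_ord_recl unlift_none; congr (_ + _).
    by apply: eq_bigr => k _; rewrite liftK.
exists [tuple w (lift ord0 k) | k < m].
  split=> [k|]; first by rewrite tnth_mktuple.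
  under eq_bigr do rewrite tnth_mktuple.
  by rewrite -w1 [leRHS]big_ord_recl lerDr.
apply: eq_from_tnth => j; rewrite affine_chartE wx [RHS]big_ord_recl.
under eq_bigr do rewrite tnth_mktuple.
congr (_ * _ + _); first by rewrite -w1 big_ord_recl addrK.
by apply: eq_bigr => k _; rewrite tnth_mktuple.
Qed.

Lemma preimage_simplex_affine_chart a : injective (affine_chart a) ->
  affine_chart a @^-1` simplex a = @std_simplex R m.
Proof.
move=> inj; rewrite -image_affine_chart; apply/seteqP; split=> [x [y Sy /inj <-]//|x Sx].
by exists x.
Qed.

End charts.

(** A form symmetric in the vertices, whereas [edge_mx] singles out the first; permuting the
    vertices relies on it. The weight of the first vertex is minus the sum of the others. *)
Lemma affinely_independentP (R : realType) (m d : nat) (a : 'I_m.+1 -> Rn R d) :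
  affinely_independent a <->
  (forall w : 'I_m.+1 -> R, \sum_k w k = 0 ->
    (forall j, \sum_k w k * tnth (a k) j = 0) -> forall k, w k = 0).
Proof.
have mulE (u : 'rV[R]_m) j : (u *m edge_mx a) 0 j =
    - (\sum_k u 0 k) * tnth (a ord0) j + \sum_k u 0 k * tnth (a (lift ord0 k)) j.
  rewrite mxE; under eq_bigr do rewrite mxE mulrBr.
  by rewrite sumrB -mulr_suml addrC mulNr.
split=> [freeE w w0 aw|indep].
  pose u : 'rV[R]_m := \row_k w (lift ord0 k).
  have uE k : u 0 k = w (lift ord0 k) by rewrite mxE.
  have w00 : w ord0 = - \sum_k u 0 k.
    apply/eqP; rewrite -addr_eq0; apply/eqP; rewrite -[RHS]w0 [RHS]big_ord_recl.
    by under eq_bigr do rewrite uE.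
  have u0 : u = 0.
    apply/eqP; rewrite -(mulmx_free_eq0 _ freeE); apply/eqP/rowP => j.
    rewrite mulE -w00 [RHS]mxE -[RHS](aw j) [RHS]big_ord_recl.
    by under eq_bigr do rewrite uE.
  move=> k; case: (unliftP ord0 k) => [k'|] ->; first by rewrite -uE u0 mxE.
  by rewrite w00 u0 big1 ?oppr0// => ? _; rewrite mxE.
apply: inj_row_free => u uE0.
pose w k := if unlift ord0 k is Some k' then u 0 k' else - \sum_k u 0 k.
have wl k : w (lift ord0 k) = u 0 k by rewrite /w liftK.
have w0 : w ord0 = - \sum_k u 0 k by rewrite /w unlift_none.
apply/rowP => k; rewrite mxE -wl; apply: indep.
  by rewrite big_ord_recl w0; under [X in _ + X]eq_bigr do rewrite wl; rewrite addNr.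
move=> j; rewrite big_ord_recl w0; under [X in _ + X]eq_bigr do rewrite wl.
by rewrite -mulE uE0 mxE.
Qed.

Lemma affinely_independent_perm (R : realType) (m d : nat)
    (a : 'I_m.+1 -> Rn R d) (s : {perm 'I_m.+1}) :
  affinely_independent a -> affinely_independent (a \o s).
Proof.
move=> /affinely_independentP ind; apply/affinely_independentP => w w0 aw k.
rewrite -[k](permK s) -[LHS]/((w \o s^-1%g) (s k)); apply: ind.
  rewrite (reindex_inj (@perm_inj _ s)) -[RHS]w0.
  by apply: eq_bigr => l _ /=; rewrite permK.
move=> j; rewrite (reindex_inj (@perm_inj _ s)) -[RHS](aw j).
by apply: eq_bigr => l _ /=; rewrite permK.
Qed.

Lemma sub_simplex_perm (R : realType) (m d : nat) (a : 'I_m.+1 -> Rn R d)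
    (s : {perm 'I_m.+1}) : simplex a `<=` simplex (a \o s).
Proof.
move=> x [w [w0 w1 wx]]; exists (w \o s); split => [k||j].
- exact: w0.
- by rewrite -w1 [RHS](reindex_inj (@perm_inj _ s)).
- by rewrite wx (reindex_inj (@perm_inj _ s)).
Qed.

Lemma simplex_perm (R : realType) (m d : nat) (a : 'I_m.+1 -> Rn R d)
    (s : {perm 'I_m.+1}) : simplex (a \o s) = simplex a.
Proof.
apply/seteqP; split; last exact: sub_simplex_perm.
have := @sub_simplex_perm R m d (a \o s) s^-1%g.
by congr (_ `<=` simplex _); apply/funext => k /=; rewrite permKV.
Qed.

Section full_chart.
Variables (R : realType) (n : nat) (b : 'I_n.+1 -> Rn R n).
Hypothesis b_indep : affinely_independent b.

Let rv (x : Rn R n) : 'rV[R]_n := \row_j tnth x j.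
Let tup (u : 'rV[R]_n) : Rn R n := [tuple u 0 j | j < n].
Let E := edge_mx b.

Let E_unit : E \in unitmx. Proof. by rewrite -row_free_unit. Qed.

Let rvK : cancel rv tup.
Proof. by move=> x; apply: eq_from_tnth => j; rewrite tnth_mktuple mxE. Qed.

Let tupK : cancel tup rv.
Proof. by move=> u; apply/rowP => j; rewrite mxE tnth_mktuple. Qed.

Let chartE x : affine_chart b x = tup (rv (b ord0) + rv x *m E).
Proof.
apply: eq_from_tnth => j; rewrite !tnth_mktuple !mxE; congr (_ + _).
by apply: eq_bigr => k _; rewrite !mxE.
Qed.

Definition affine_chart_inv (x : Rn R n) : Rn R n :=
  tup ((rv x - rv (b ord0)) *m invmx E).

Lemma affine_chartK : cancel (affine_chart b) affine_chart_inv.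
Proof.
move=> x; rewrite chartE /affine_chart_inv tupK addrC addKr.
by rewrite mulmxK// rvK.
Qed.

Lemma affine_chart_invK : cancel affine_chart_inv (affine_chart b).
Proof.
by move=> x; rewrite chartE /affine_chart_inv tupK mulmxKV// addrC subrK rvK.
Qed.

Lemma measurable_affine_chart_inv : measurable_fun setT affine_chart_inv.
Proof.
apply/measurable_fun_tnthP => j.
rewrite (_ : _ \o _ = fun x =>
  \sum_k (tnth x k - tnth (b ord0) k) * invmx E k j); last first.
  apply/funext => x /=; rewrite tnth_mktuple mxE.
  by apply: eq_bigr => k _; rewrite !mxE.
apply: measurable_sum => k; apply: measurable_funM => //.
by apply: measurable_funB => //; exact: measurable_tnth.
Qed.

(** Translating by [s] after the chart is translating by [s E^-1] before it, so
    [lebesgue_equivariant] applies. *)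
Lemma lebesgue_affine_chart : exists2 c : R, 0 < c & forall A, measurable A ->
  lebesgue R n (affine_chart b @^-1` A) = (c%:E * lebesgue R n A)%E.
Proof.
apply: (@lebesgue_equivariant R n (affine_chart b) affine_chart_inv).
- exact: measurable_affine_chart.
- exact: measurable_affine_chart_inv.
- exact: affine_chartK.
- exact: affine_chart_invK.
move=> s; exists (tup (rv s *m invmx E)) => x.
have rvD y z : rv (addRn y z) = rv y + rv z.
  by apply/rowP => j; rewrite !mxE tnth_mktuple.
apply: (can_inj rvK); rewrite rvD !chartE !tupK rvD tupK mulmxDl mulmxKV//.
by rewrite addrCA.
Qed.

Lemma measurable_image_affine_chart D : measurable D -> measurable (affine_chart b @` D).
Proof.
move=> mD; rewrite (_ : _ @` _ = affine_chart_inv @^-1` D).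
  exact: measurable_preimage measurable_affine_chart_inv mD.
apply/seteqP; split=> [_ [x Dx <-] /=|x Dx]; first by rewrite affine_chartK.
by exists (affine_chart_inv x) => //; rewrite affine_chart_invK.
Qed.

End full_chart.

(** * Simplices as cones over a face *)

Section cone.
Variables (R : realType) (d : nat) (a : 'I_d.+2 -> Rn R d.+1) (i : 'I_d.+2).

(** The factors act from left to right: 0 and 1 are swapped, then 0 goes to [i] and the others go in
    order to the remaining indices. *)
Definition cone_perm : {perm 'I_d.+2} :=
  (tperm ord0 (lift ord0 ord0) * lift_perm ord0 i 1)%g.

(* The apex [a i] comes second, so that the first coordinate of the chart is the
   height above the face. *)
Definition cone_vertices : 'I_d.+2 -> Rn R d.+1 := a \o cone_perm.

Lemma cone_vertices0 : cone_vertices ord0 = face_vertices a i ord0.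
Proof. by rewrite /cone_vertices/= permM tpermL lift_perm_lift perm1. Qed.

Lemma cone_vertices1 : cone_vertices (lift ord0 ord0) = a i.
Proof. by rewrite /cone_vertices/= permM tpermR lift_perm_id. Qed.

Lemma cone_verticesS k : cone_vertices (lift ord0 (lift ord0 k)) =
  face_vertices a i (lift ord0 k).
Proof.
rewrite /cone_vertices/= permM tpermD ?lift_perm_lift ?perm1//.
Qed.

(** Scaling the base by [1 - t] is what makes the chart affine in [t]: it traces the segment from a
    point of the face to the apex. *)
Lemma cone_chartE (t : R) (z : Rn R d) j :
  tnth (affine_chart cone_vertices (cons_Rn (t, scaleRn (1 - t) z))) j =
  tnth (affine_chart (face_vertices a i) z) j +
  (tnth (a i) j - tnth (affine_chart (face_vertices a i) z) j) * t.
Proof.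
rewrite !affine_chartE !big_ord_recl tnth0 cone_vertices0 cone_vertices1.
under eq_bigr do rewrite tnthS tnth_mktuple.
under [X in _ + (_ + X)]eq_bigr do
  rewrite tnthS tnth_mktuple cone_verticesS -mulrA.
rewrite -!mulr_sumr /=; ring.
Qed.

(** The face chart is the bottom slice of the cone chart, from which it inherits injectivity. *)
Lemma cone_chart0 (z : Rn R d) :
  affine_chart cone_vertices (cons_Rn (0, z)) = affine_chart (face_vertices a i) z.
Proof.
apply: eq_from_tnth => j; have := cone_chartE 0 z j; rewrite mulr0 addr0 => <-.
congr (tnth (affine_chart _ (cons_Rn (_, _))) _).
by apply: eq_from_tnth => k; rewrite tnth_mktuple subr0 mul1r.
Qed.

End cone.

(** * The discrete trace inequality on a simplex *)

Local Open Scope ereal_scope.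

Theorem lemma4p2 (R : realType) (d : nat) (a : 'I_d.+2 -> Rn R d.+1)
    (i : 'I_d.+2) (q : R) (r : nat) (v : Rn R d.+1 -> R) :
  let K := simplex a in
  let F := simplex (face_vertices a i) in
  let dx := lebesgue R d.+1 in
  let ds := surface_measure (face_vertices a i) in
  (d.+1 <= 3)%N ->
  affinely_independent a ->
  (0 < q)%R ->
  polynomials_on r K v ->
  \int[ds]_(x in F) (`|v x| `^ q)%:E <=
  (2 `^ (q + 1) * C_inv R d.+1)%:E *
    ((2 * r ^ 2 + 1)%:R%:E * ds F / (d.+1%:R%:E * dx K)) *
    \int[dx]_(x in K) (`|v x| `^ q)%:E.
Proof.
move=> K F dx ds d3 indep q0 [p pr vp].
pose Phi := affine_chart (cone_vertices a i).
pose chi := affine_chart (face_vertices a i).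
have cone_indep : affinely_independent (cone_vertices a i).
  exact: affinely_independent_perm.
have [c c0 cE] := lebesgue_affine_chart cone_indep.
have Phi_inj : injective Phi := can_inj (affine_chartK cone_indep).
have Phi0 z : Phi (cons_Rn (0%R, z)) = chi z := cone_chart0 a i z.
have chi_inj : injective chi.
  move=> y z; rewrite -!Phi0 => /Phi_inj /(congr1 uncons_Rn).
  by rewrite !cons_RnK => -[].
have KE : K = simplex (cone_vertices a i) by rewrite simplex_perm.
have PhiK : Phi @^-1` K = @std_simplex R d.+1.
  by rewrite KE preimage_simplex_affine_chart.
have chiF : chi @^-1` F = @std_simplex R d by rewrite preimage_simplex_affine_chart.
have mK : measurable K.
  rewrite KE -image_affine_chart; apply: measurable_image_affine_chart => //.
  exact: measurable_std_simplex.
(* As the image of the bottom facet, the face is seen to be measurable and contained in [K]. *)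
have FE : F = Phi @` (uncons_Rn @^-1` ([set 0%R] `*` @std_simplex R d)).
  rewrite /F -image_affine_chart.
  apply/seteqP; split=> [_ [z Sz <-]|_ [x [/= x0 Sx] <-]].
    exists (cons_Rn (0%R, z)); last exact: Phi0.
    change (([set 0%R] `*` @std_simplex R d) (uncons_Rn (cons_Rn (0%R, z)))).
    by rewrite cons_RnK.
  exists [tuple of behead x] => //; rewrite -/(chi _) -Phi0; congr Phi.
  by rewrite -x0 /cons_Rn/=; apply/val_inj; rewrite /= [in RHS](tuple_eta x).
have mF : measurable F.
  rewrite FE; apply: measurable_image_affine_chart => //.
  apply: (measurable_preimage (@measurable_uncons_Rn R d)); apply: measurableX => //.
  exact: measurable_std_simplex.
have FK : F `<=` K.
  rewrite FE KE -image_affine_chart => _ [x [/= x0 [Sx0 Sx1]] <-]; exists x => //.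
  have xE : x = cons_Rn (0%R, [tuple of behead x]).
    by rewrite -x0 /cons_Rn/=; apply/val_inj; rewrite /= [in LHS](tuple_eta x).
  rewrite xE; split=> [j|].
    by case: (unliftP ord0 j) => [j'|] ->; rewrite ?tnthS ?tnth0.
  rewrite big_ord_recl tnth0 add0r.
  by under eq_bigr do rewrite tnthS.
(* [v] is controlled on [K] only; there the polynomial replaces it, and it is measurable on the
   whole space. *)
pose f x : \bar R := (`|mpoly.meval (tnth x) p| `^ q)%:E.
have f0 x : 0 <= f x by rewrite lee_fin powR_ge0.
have mf : measurable_fun setT f.
  apply/measurable_EFinP/(measurableT_comp (measurable_powR q)).
  by apply: measurableT_comp => //; exact: measurable_meval.
have vf (D : set (Rn R d.+1)) : D `<=` K -> {in D, forall x, (`|v x| `^ q)%:E = f x}.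
  by move=> DK x /set_mem /DK Kx; rewrite /f vp.
rewrite (eq_integral _ _ (vf F FK)) (eq_integral _ _ (vf K (@subset_refl _ _))).
pose E := edge_mx (face_vertices a i).
set sG := Num.sqrt (\det (E *m E^T)).
have sG0 : (0 <= sG)%R := sqrtr_ge0 _.
have -> : \int[ds]_(x in F) f x =
    sG%:E * \int[lebesgue R d]_(z in @std_simplex R d) f (chi z).
  pose M := measure_function_pushforward__canonical__measure_function_Measure
    (lebesgue R d) (measurable_affine_chart (face_vertices a i)).
  transitivity (\int[mscale (NngNum sG0) M]_(x in F) f x).
    exact: eq_measure_integral.
  rewrite ge0_integral_mscale//; last exact: measurable_funTS.
  congr (_ * _); rewrite -chiF.
  apply: (ge0_integral_pushforward (measurable_affine_chart _)) => //.
  exact: measurable_funTS.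
have [V V0 VE] := lebesgue_std_simplex_gt0 R d.
have dsF : ds F = (sG * V)%:E.
  by rewrite /ds/= /surface_measure /pushforward -/chi chiF VE.
(* The preimage of [K] under the chart is the standard simplex, so [c |K|] is its volume
   [V / (d+1)]. *)
have dxK : dx K = ((d.+1%:R)^-1 * V / c)%:E.
  have := cE K mK; rewrite -/Phi PhiK lebesgue_std_simplexS VE -/dx -EFinM => e.
  have -> : dx K = (c^-1)%:E * (c%:E * dx K).
    by rewrite muleA -EFinM mulVf ?mul1e// gt_eqF.
  by rewrite -e -EFinM mulrC.
(* [V] and the dimension cancel; positivity of the denominator makes the extended quotient a real
   one. *)
have -> : (2 * r ^ 2 + 1)%:R%:E * ds F / (d.+1%:R%:E * dx K) =
    ((2 * r ^ 2 + 1)%:R * sG * c)%:E.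
  rewrite dsF dxK -!EFinM inver ifF; last first.
    by rewrite gt_eqF// !mulr_gt0// ?invr_gt0// ltr0n.
  by rewrite -EFinM; congr EFin; field; rewrite !gt_eqF// ltr0n.
have C0 : (0 <= 2 `^ (q + 1) * C_inv R d.+1 * (2 * r ^ 2 + 1)%:R :> R)%R.
  rewrite !mulr_ge0// ?powR_ge0//.
  by case: (d) => [|[|[|]]].
set C : R := (2 `^ (q + 1) * C_inv R d.+1 * (2 * r ^ 2 + 1)%:R)%R in C0 *.
(* The inequality without the common factor [sG], over the parameter domain of the face. *)
have key : \int[lebesgue R d]_(z in @std_simplex R d) f (chi z) <=
    C%:E * (c%:E * \int[dx]_(x in K) f x).
  have mS := @measurable_std_simplex R d.
  have mfPhi : measurable_fun setT (f \o Phi).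
    exact: measurableT_comp mf (measurable_affine_chart _).
  rewrite -(ge0_integral_comp_proportional (measurable_affine_chart _) (ltW c0)
    cE)//; last exact: measurable_funTS.
  rewrite -/Phi PhiK ge0_integral_duffy//.
  have fPhi0 x : 0 <= (f \o Phi) x := f0 (Phi x).
  rewrite -ge0_integralZl_EFin//; last 2 first.
  - move=> z _; apply: integral_ge0 => t; rewrite /= in_itv/= => /andP[_ t1].
    by rewrite mule_ge0// lee_fin exprn_ge0// subr_ge0 ltW.
  - exact: (measurable_integral_duffy mfPhi fPhi0).
  apply: ge0_le_integral => //.
  - apply: measurable_funTS.
    exact: measurableT_comp mf (measurable_affine_chart _).
  - apply: measurable_funeM.
    exact: (measurable_integral_duffy mfPhi fPhi0).
  move=> z Sz.
  (* [g] is the polynomial along the segment from [chi z] to the apex; the univariate bound is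
     applied for each [z]. *)
  have [g sg gE] := meval_line (tnth (chi z))
    (fun j => tnth (a i) j - tnth (chi z) j)%R pr.
  have gf t : f (Phi (cons_Rn (t, scaleRn (1 - t)%R z))) = (`|g.[t]| `^ q)%:E.
    rewrite /f gE; congr ((`|_| `^ q)%:E); apply: mpoly.meval_eq => j.
    exact: cone_chartE.
  have -> : f (chi z) = (`|g.[0]| `^ q)%:E.
    rewrite /f gE; congr ((`|_| `^ q)%:E); apply: mpoly.meval_eq => j.
    by rewrite mulr0 addr0.
  apply: (le_trans (endpoint_le_C_inv d3 sg q0)).
  rewrite -/C; apply: lee_wpmul2l; first by rewrite lee_fin.
  rewrite le_eqVlt; apply/orP; left; apply/eqP; apply: eq_integral => t _.
  by rewrite gf EFinM.
apply: (le_trans (lee_wpmul2l _ key)); first by rewrite lee_fin.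
rewrite !muleA -!EFinM lee_wpmul2r//; first exact: integral_ge0.
rewrite lee_fin le_eqVlt; apply/orP; left; apply/eqP; rewrite /C; ring.
Qed.
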